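(* Let $(\mathbf{x}_i,y_i)\in\mathbb{R}^d\times\{-1,+1\}$, $i=1,\ldots,n$, let $f^1,\ldots,f^m:\mathbb{R}^d\to\{-1,+1\}$ be auxiliary classifiers, put $\mathbf{f}_i=[f^1(\mathbf{x}_i),\ldots,f^m(\mathbf{x}_i)]^\top\in\mathbb{R}^m$, and let $B>0$ and $C>0$. Consider the classifier adaptation problem with linear delta function $$\text{(P1)}\quad \min_{\mathbf{a}\in\mathbb{R}^m,\ \mathbf{w}\in\mathbb{R}^d,\ \xi\ge 0}\ \tfrac12\|\mathbf{w}\|^2+\tfrac12 B\|\mathbf{a}\|^2+C\xi$$ $$\text{s.t. for all }\bar{y}'\in\mathcal{Y}^n\setminus\{\bar{y}\}:\quad \begin{bmatrix}\mathbf{a}\\ \mathbf{w}\end{bmatrix}^\top\left[\Psi(\bar{\mathbf{x}},\bar{y})-\Psi(\bar{\mathbf{x}},\bar{y}')\right]\ge\Delta(\bar{y},\bar{y}')-\xi,\qquad \Psi(\bar{\mathbf{x}},\bar{y}')=\sum_{i=1}^n y_i'\begin{bmatrix}\mathbf{f}_i\\ \mathbf{x}_i\end{bmatrix}.$$ Then, with $$\mathbf{v}=\begin{bmatrix}\sqrt{B}\,\mathbf{a}\\ \mathbf{w}\end{bmatrix}\quad\text{and}\quad \mathbf{x}_i'=\begin{bmatrix}\frac{1}{\sqrt{B}}\,\mathbf{f}_i\\ \mathbf{x}_i\end{bmatrix},$$ problem (P1) can be written as the quadratic program $$\text{(P2)}\quad \min_{\mathbf{v}\in\mathbb{R}^{m+d},\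 \xi\ge 0}\ \tfrac12\|\mathbf{v}\|^2+C\xi\quad\text{s.t. for all }\bar{y}'\in\mathcal{Y}^n\setminus\{\bar{y}\}:\quad \mathbf{v}^\top\left[\sum_{i=1}^n y_i\mathbf{x}_i'-\sum_{i=1}^n y_i'\mathbf{x}_i'\right]\ge\Delta(\bar{y},\bar{y}')-\xi.$$ That is, the map $(\mathbf{a},\mathbf{w},\xi)\mapsto(\mathbf{v},\xi)$ is a bijection from the feasible set of (P1) onto the feasible set of (P2) which preserves the objective value.
   Context: $\mathcal{Y}^n\subseteq\{-1,+1\}^n$ is the set of admissible label vectors, $\bar{\mathbf{x}}=(\mathbf{x}_1,\ldots,\mathbf{x}_n)$, $\bar{y}=(y_1,\ldots,y_n)\in\mathcal{Y}^n$ is the true label vector, and $\bar{y}'=(y_1',\ldots,y_n')$ ranges over label vectors. $\Delta(\bar{y},\bar{y}')\in\mathbb{R}$ is an arbitrary loss of predicting $\bar{y}'$ when the truth is $\bar{y}$. $\|\cdot\|$ is the Euclidean norm. (P2) has exactly the form of the linear SVM$^{\text{perf}}$ training problem on the augmented data $(\mathbf{x}_i',y_i)$. *)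

(* Defs.v *)
From mathcomp Require Import all_boot all_order all_algebra.
From mathcomp Require Import boolp classical_sets functions reals.

Set Implicit Arguments.
Unset Strict Implicit.
Unset Printing Implicit Defensive.

Import Order.TTheory GRing.Theory Num.Theory.
Local Open Scope classical_set_scope.
Local Open Scope ring_scope.

(* Labels are real numbers, so that they can scale feature vectors. *)
Definition is_label (R : realType) (r : R) : Prop := r = -1 \/ r = 1.

Definition label_vectors (R : realType) (n : nat) : set 'cV[R]_n :=
  [set y | forall i, is_label (y i 0)].

Definition dot (R : realType) (p : nat) (u v : 'cV[R]_p) : R :=
  (u^T *m v) 0 0.

(* The norm that MathComp-Analysis puts on matrices is the maximum norm, hence
   this definition of the Euclidean one. *)
Definition enorm (R : realType) (p : nat) (v : 'cV[R]_p) : R :=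
  Num.sqrt (\sum_i v i 0 ^+ 2).

Definition aux_outputs (R : realType) (d m : nat)
    (f : 'I_m -> 'cV[R]_d -> R) (x : 'cV[R]_d) : 'cV[R]_m :=
  \col_k f k x.

Definition Psi (R : realType) (n d m : nat) (f : 'I_m -> 'cV[R]_d -> R)
    (x : 'I_n -> 'cV[R]_d) (y' : 'cV[R]_n) : 'cV[R]_(m + d) :=
  \sum_i y' i 0 *: col_mx (aux_outputs f (x i)) (x i).

Definition P1_objective (R : realType) (d m : nat) (B C : R)
    (p : 'cV[R]_m * 'cV[R]_d * R) : R :=
  let: (a, w, xi) := p in
  2^-1 * enorm w ^+ 2 + 2^-1 * B * enorm a ^+ 2 + C * xi.

Definition P1_feasible (R : realType) (n d m : nat) (Y : set 'cV[R]_n)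
    (Delta : 'cV[R]_n -> 'cV[R]_n -> R) (f : 'I_m -> 'cV[R]_d -> R)
    (x : 'I_n -> 'cV[R]_d) (y : 'cV[R]_n) : set ('cV[R]_m * 'cV[R]_d * R) :=
  [set p | let: (a, w, xi) := p in
    0 <= xi /\
    forall y', (Y `\ y) y' ->
      dot (col_mx a w) (Psi f x y - Psi f x y') >= Delta y y' - xi].

(* The linear SVM^perf training problem on arbitrary data (z_i, y_i) with z_i in
   R^p; (P2) is its instance at z = augmented B f x. *)
Definition svmperf_objective (R : realType) (p : nat) (C : R)
    (q : 'cV[R]_p * R) : R :=
  let: (v, xi) := q in 2^-1 * enorm v ^+ 2 + C * xi.

Definition svmperf_feasible (R : realType) (n p : nat) (Y : set 'cV[R]_n)
    (Delta : 'cV[R]_n -> 'cV[R]_n -> R) (z : 'I_n -> 'cV[R]_p)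
    (y : 'cV[R]_n) : set ('cV[R]_p * R) :=
  [set q | let: (v, xi) := q in
    0 <= xi /\
    forall y', (Y `\ y) y' ->
      dot v (\sum_i y i 0 *: z i - \sum_i y' i 0 *: z i)
        >= Delta y y' - xi].

Definition augmented (R : realType) (n d m : nat) (B : R)
    (f : 'I_m -> 'cV[R]_d -> R) (x : 'I_n -> 'cV[R]_d) (i : 'I_n) :
    'cV[R]_(m + d) :=
  col_mx ((Num.sqrt B)^-1 *: aux_outputs f (x i)) (x i).

Definition change_of_variables (R : realType) (d m : nat) (B : R)
    (p : 'cV[R]_m * 'cV[R]_d * R) : 'cV[R]_(m + d) * R :=
  let: (a, w, xi) := p in (col_mx (Num.sqrt B *: a) w, xi).

(* Main.v *)
Require Import Defs.
From mathcomp Require Import all_boot all_order all_algebra.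
From mathcomp Require Import boolp classical_sets functions reals.

Set Implicit Arguments.
Unset Strict Implicit.
Unset Printing Implicit Defensive.

Import Order.TTheory GRing.Theory Num.Theory.
Local Open Scope classical_set_scope.
Local Open Scope ring_scope.

(** Multiplying the [a]-block by [Num.sqrt B] and the auxiliary features by its inverse leaves every
    inner product between parameters and features unchanged, so the two problems have the same
    constraints, one for each [y'] ([dot_augmented], [change_of_variables_feasible]). The factor [B]
    of the regularizer is absorbed into the norm of the rescaled block
    ([change_of_variables_objective]). As [Num.sqrt B] is nonzero, the map is invertible on the
    whole space ([change_of_variables_bij]), and the equivalence of constraints restricts it to a
    bijection of the feasible sets. *)

Lemma sum_scale_col_mx (R : realType) (n p q : nat) (c : 'I_n -> R)
    (u : 'I_n -> 'cV[R]_p) (v : 'I_n -> 'cV[R]_q) :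
  \sum_i c i *: col_mx (u i) (v i) =
  col_mx (\sum_i c i *: u i) (\sum_i c i *: v i).
Proof.
(* The three sums grow together, the third being always the stack of the other two. *)
apply: (big_rec3 (fun s t r => r = col_mx s t)) => [|i s t r _ ->].
  by rewrite col_mx0.
by rewrite scale_col_mx add_col_mx.
Qed.

Lemma dot_col_mx (R : realType) (p q : nat) (a b : 'cV[R]_p)
    (w u : 'cV[R]_q) :
  dot (col_mx a w) (col_mx b u) = dot a b + dot w u.
Proof. by rewrite /dot tr_col_mx mul_row_col mxE. Qed.

Lemma dot_scale (R : realType) (p : nat) (s t : R) (a b : 'cV[R]_p) :
  dot (s *: a) (t *: b) = s * t * dot a b.
Proof.
by rewrite /dot -scalemxAr [(s *: a)^T]linearZ /= -scalemxAl scalerA mxE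
  [t * s]mulrC.
Qed.

Lemma enorm_sqr (R : realType) (p : nat) (v : 'cV[R]_p) :
  enorm v ^+ 2 = dot v v.
Proof.
rewrite sqr_sqrtr; last by apply: sumr_ge0 => i _; apply: sqr_ge0.
by rewrite /dot mxE; apply: eq_bigr => i _; rewrite mxE expr2.
Qed.

(** The two scalings cancel in the upper block, and the lower block is untouched. *)
Lemma dot_augmented (R : realType) (n d m : nat) (B : R)
    (f : 'I_m -> 'cV[R]_d -> R) (x : 'I_n -> 'cV[R]_d) (y y' : 'cV[R]_n)
    (a : 'cV[R]_m) (w : 'cV[R]_d) :
  0 < B ->
  dot (col_mx (Num.sqrt B *: a) w)
    (\sum_i y i 0 *: augmented B f x i - \sum_i y' i 0 *: augmented B f x i) =
  dot (col_mx a w) (Psi f x y - Psi f x y').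
Proof.
move=> B0; have s0 : Num.sqrt B != 0 by rewrite gt_eqF// sqrtr_gt0.
(* The scaling is the same for all examples, so it leaves the sum and can meet the factor
   [Num.sqrt B] of [a] in a single product. *)
have sumZ (c : 'cV[R]_n) :
    \sum_i c i 0 *: ((Num.sqrt B)^-1 *: aux_outputs f (x i)) =
    (Num.sqrt B)^-1 *: \sum_i c i 0 *: aux_outputs f (x i).
  by rewrite scaler_sumr; apply: eq_bigr => i _; rewrite !scalerA mulrC.
rewrite /Psi /augmented !sum_scale_col_mx !sumZ !opp_col_mx !add_col_mx.
by rewrite -scalerBr !dot_col_mx dot_scale mulfV// mul1r.
Qed.

(** The slack [xi] is carried over unchanged, so only the inner products have to be compared. One
    direction of the equivalence shows that the image is feasible, the other that preimages are,
    which gives surjectivity. *)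
Lemma change_of_variables_feasible (R : realType) (n d m : nat)
    (Y : set 'cV[R]_n) (Delta : 'cV[R]_n -> 'cV[R]_n -> R)
    (x : 'I_n -> 'cV[R]_d) (y : 'cV[R]_n) (f : 'I_m -> 'cV[R]_d -> R)
    (B : R) (p : 'cV[R]_m * 'cV[R]_d * R) :
  0 < B ->
  svmperf_feasible Y Delta (augmented B f x) y (change_of_variables B p) <->
  P1_feasible Y Delta f x y p.
Proof.
case: p => [[a w] xi] B0 /=; split=> -[xi0 H]; split=> // y' Yy'.
  by rewrite -(dot_augmented _ _ _ _ _ _ B0); apply: H.
by rewrite dot_augmented//; apply: H.
Qed.

Lemma change_of_variables_bij (R : realType) (d m : nat) (B : R) :
  0 < B -> bijective (@change_of_variables R d m B).
Proof.
move=> B0; have s0 : Num.sqrt B != 0 by rewrite gt_eqF// sqrtr_gt0.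
exists (fun q => ((Num.sqrt B)^-1 *: usubmx q.1, dsubmx q.1, q.2)).
  by move=> [[a w] xi] /=; rewrite col_mxKu col_mxKd scalerA mulVf// scale1r.
by move=> [v xi] /=; rewrite scalerA mulfV// scale1r vsubmxK.
Qed.

(** Pythagoras for the two blocks, together with the fact that [Num.sqrt B] squares to [B]. *)
Lemma change_of_variables_objective (R : realType) (d m : nat) (B C : R)
    (p : 'cV[R]_m * 'cV[R]_d * R) :
  0 <= B -> svmperf_objective C (change_of_variables B p) = P1_objective B C p.
Proof.
case: p => [[a w] xi] B0 /=; congr (_ + _).
by rewrite !enorm_sqr dot_col_mx dot_scale -expr2 sqr_sqrtr//
  mulrDr mulrA addrC.
Qed.

Theorem mainTheorem2 (R : realType) (n d m : nat)
    (Y : set 'cV[R]_n) (Delta : 'cV[R]_n -> 'cV[R]_n -> R)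
    (x : 'I_n -> 'cV[R]_d) (y : 'cV[R]_n)
    (f : 'I_m -> 'cV[R]_d -> R) (B C : R)
    (hY : Y `<=` @label_vectors R n) (hy : Y y)
    (hf : forall k u, is_label (f k u))
    (hB : 0 < B) (hC : 0 < C) :
  set_bij (P1_feasible Y Delta f x y)
          (svmperf_feasible Y Delta (augmented B f x) y)
          (change_of_variables B) /\
  (forall p, P1_feasible Y Delta f x y p ->
     svmperf_objective C (change_of_variables B p) = P1_objective B C p).
Proof.
split; last by move=> p _; apply: change_of_variables_objective; apply: ltW.
have [g gK Kg] := @change_of_variables_bij R d m B hB.
split.
- by move=> p /(change_of_variables_feasible _ _ _ _ _ _ hB).
- by move=> p q _ _; apply: can_inj gK _ _.
(* The global inverse [g] supplies the preimage, which is feasible because its image is the feasible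
   point [q]. *)
- move=> q Fq; exists (g q); last exact: Kg.
  by apply/(change_of_variables_feasible _ _ _ _ _ _ hB); rewrite Kg.
Qed.
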